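(* Let $A_n^{(2)}(x)$ be the $1/2$-Eulerian polynomials, and let $W_n(x)$ be the interior peak polynomials. Then for $n\ge1$, $$A_n^{(2)}(x)=\sum_{T\in\mathrm{SYT}(n)}x^{n-\ell(\lambda(T))}\prod_{i=1}^n\sigma_i(T)\left(W_i\!\left(\frac1x\right)\right)^{w_i(T)}.$$
   Context: The $1/2$-Eulerian polynomials are defined by $$\left(2x\frac{\mathrm d}{\mathrm dx}\right)^n\frac1{\sqrt{1-x}}=\frac{x^nA_n^{(2)}(1/x)}{(1-x)^{n+\frac12}}.$$ $W_n(x)=\sum_{\pi\in\mathfrak S_n}x^{\mathrm{ipk}(\pi)}$, where $\mathfrak S_n$ is the symmetric group on $[n]$ and $\mathrm{ipk}(\pi)=\#\{i: 2\le i\le n-1,\ \pi(i-1)<\pi(i)>\pi(i+1)\}$. A standard Young tableau of size $n$ is a filling of the Ferrers diagram of a partition $\lambda\vdash n$ (French convention: left-justified rows numbered from bottom to top, $\lambda_i$ boxes in row $i$) with $1,\dots,n$, each used exactly once, increasing from left to right in rows and from bottom to top in columns; $\mathrm{SYT}(n)$ is the set of all of them, over all $\lambda\vdash n$. For $T\in\mathrm{SYT}(n)$, $\ell(\lambda(T))$ is the number of rows of $T$, $w_i(T)$ is the number of rows of $T$ with exactly $i$ boxes, $T_i$ is the tableau obtained from $T$ by deleting the entries $i+1,\dots,n$, and $\mathrm{col}_k(T_i)$ is the number of boxes in the $k$-th column of $T_i$. The box sorting index of $i$ is $$\sigma_i(T)=\begin{cases} i-\mathrm{col}_1(T_i)+1,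 & \text{if } i \text{ is in the first column of } T,\\ \mathrm{col}_k(T_i)-\mathrm{col}_{k+1}(T_i)+1, & \text{if } i \text{ is in the } (k+1)\text{-th column of } T,\ k\ge1.\end{cases}$$ *)

(* Defs.v *)
From HB Require Import structures.
From mathcomp Require Import all_boot all_order all_algebra perm.
From mathcomp Require Import all_classical all_reals all_analysis.
Import Order.TTheory GRing.Theory Num.Theory.
Import numFieldNormedType.Exports.

Set Implicit Arguments.
Unset Strict Implicit.
Unset Printing Implicit Defensive.

Local Open Scope ring_scope.

Definition two_x_ddx (R : realType) (f : R -> R) : R -> R :=
  fun x => 2 * x * derive1 f x.

Definition inv_sqrt_one_minus (R : realType) : R -> R :=
  fun x => (Num.sqrt (1 - x))^-1.

(* The defining identity is required wherever both sides make sense over the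
   reals: x < 1 for the square root, x <> 0 for A(1/x). *)
Definition is_half_eulerian (R : realType) (n : nat) (A : {poly R}) : Prop :=
  forall x : R, x != 0 -> x < 1 ->
    iter n (@two_x_ddx R) (@inv_sqrt_one_minus R) x =
    x ^+ n * A.[x^-1] / ((1 - x) `^ (n%:R + 2^-1)).

(* At most one polynomial satisfies the identity; the default value 0 never
   does. *)
Definition half_eulerian (R : realType) (n : nat) : {poly R} :=
  xget 0 (fun A : {poly R} => is_half_eulerian n A).

Definition ipk (n : nat) (s : 'S_n) : nat :=
  #|[set i : 'I_n | [exists j : 'I_n, [exists k : 'I_n,
      [&& i == j.+1 :> nat, k == i.+1 :> nat,
          (s j < s i)%N & (s k < s i)%N]]]]|.

Definition peak_poly (R : realType) (n : nat) : {poly R} :=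
  \sum_(s : 'S_n) 'X^(ipk s).

(* Partitions of n are padded with zeros to length n. *)
Definition is_partition (n : nat) (lam : {ffun 'I_n -> 'I_n.+1}) : bool :=
  [forall i : 'I_n, forall j : 'I_n, (i <= j)%N ==> (lam j <= lam i)%N]
  && ((\sum_(i < n) lam i)%N == n).

(* Boxes are pairs (row, column), both numbered from 0, row 0 at the bottom. *)
Definition ferrers (n : nat) (lam : {ffun 'I_n -> 'I_n.+1}) :
    {set 'I_n * 'I_n} :=
  [set c : 'I_n * 'I_n | (c.2 < lam c.1)%N].

(* A filling of a diagram by 1, ..., n, each used once, is recorded as the
   bijection T sending m : 'I_n to the box that contains the entry m.+1. *)
Definition SYT (n : nat) : {set {ffun 'I_n -> 'I_n * 'I_n}} :=
  [set T : {ffun 'I_n -> 'I_n * 'I_n} |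
    [&& injectiveb T,
        [exists lam : {ffun 'I_n -> 'I_n.+1},
           is_partition lam && ([set T m | m : 'I_n] == ferrers lam)],
        [forall a : 'I_n, forall b : 'I_n,
           ((T a).1 == (T b).1) && ((T a).2 < (T b).2)%N ==> (a < b)%N]
      & [forall a : 'I_n, forall b : 'I_n,
           ((T a).2 == (T b).2) && ((T a).1 < (T b).1)%N ==> (a < b)%N]]].

Definition row_len (n : nat) (T : {ffun 'I_n -> 'I_n * 'I_n}) (r : 'I_n) : nat :=
  #|[set m : 'I_n | (T m).1 == r]|.

Definition num_rows (n : nat) (T : {ffun 'I_n -> 'I_n * 'I_n}) : nat :=
  #|[set r : 'I_n | (0 < row_len T r)%N]|.

Definition num_rows_of_len (n : nat) (T : {ffun 'I_n -> 'I_n * 'I_n})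
    (i : nat) : nat :=
  #|[set r : 'I_n | row_len T r == i]|.

(* Number of boxes in column k (from 0) among the entries 1, ..., i. *)
Definition col_len (n : nat) (T : {ffun 'I_n -> 'I_n * 'I_n})
    (i k : nat) : nat :=
  #|[set m : 'I_n | (m < i)%N && ((T m).2 == k :> nat)]|.

(* The index of the entry m.+1. When T is in SYT n the subtractions do not
   truncate, as column lengths are weakly decreasing. *)
Definition box_sorting_index (n : nat) (T : {ffun 'I_n -> 'I_n * 'I_n})
    (m : 'I_n) : nat :=
  match nat_of_ord (T m).2 with
  | 0 => (m.+1 - col_len T m.+1 0 + 1)%N
  | k.+1 => (col_len T m.+1 k - col_len T m.+1 k.+1 + 1)%N
  end.

(* Main.v *)
Require Import Defs.
From HB Require Import structures.
From mathcomp Require Import all_boot all_order all_algebra perm.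
From mathcomp Require Import all_classical all_reals all_analysis.
From mathcomp Require Import zify ring.
Import Order.TTheory GRing.Theory Num.Theory.
Import numFieldNormedType.Exports.

(** Both sides, multiplied by [x], compute [(c D)^n c], where [c D] is the
    operator [a |-> c * D a] for a derivation [D] and an element [c] of a
    commutative ring.

    Write [c_k = D^k c]. Applying [c D] to a monomial in the [c_k] adds a
    factor [c_0] and turns one of the factors [c_k] into [c_(k+1)]. Read a
    factor [c_k] as a row of length [k], the rows of length 0 being a reserve
    which gains one element at each step: the step puts the new entry in
    column [k+1] (from 1) at the end of a row of length [k], and the number of
    such rows is the box sorting index of the entry. Hence [(c D)^n c] is the
    sum over [T] in [SYT n] of the product of the box sorting indices times
    [c_0 ^ (n + 1 - l)], with [l] the number of rows, times the product of the
    [c_i ^ w_i] ([iter_mul_derivation]). Tableaux enter through the word of the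
    columns of their entries; these words are exactly the ballot words
    ([perm_col_words]).

    Now let [c = 'X] be the variable of a polynomial ring and let [D] be the
    derivation with [D c = c^2 / x + 1 - x]. This is the Riccati equation of the
    exponential generating function of the polynomials [W_n(1/x)], shifted by
    [x], so [c_k] takes the value [W_k(1/x)] at [c = x] for [k >= 1], while
    [c_0] takes the value [x] ([horner_iter_riccati_deriv]). The sum over
    tableaux becomes [x] times the right-hand side. The values of [c_k] follow
    from a grammar, [c -> s], [s -> 2 d s], [d -> s / x] with [d = c / x], in
    which the terms of [D^n c] correspond to permutations, and [D] to the
    insertion of a new maximum ([iter_derivation_peak]).

    On the other hand [(c D)^n c] depends only on [c], [a = c d] and [s], which
    [c D] maps to [c s], [2 a s] and [2 a s] ([iter_mul_derivation_half_eul]).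
    The operator [2 t d/dt] maps [1 / sqrt (1 - t)], [1 / (1 - t)] and
    [t / (1 - t)] according to the same rules ([iter_two_x_ddx]). The same
    integers [half_eul_coef n k] therefore expand both iterates; the second
    expansion identifies them as the coefficients of the 1/2-Eulerian polynomial
    ([half_eulerianE]), and the first one, at [c = x] where [a = x] and [s = 1],
    is [x] times that polynomial at [x] ([horner_iter_mul_riccati_deriv]). *)

Set Implicit Arguments.
Unset Strict Implicit.
Unset Printing Implicit Defensive.

(** * Interior peaks and insertion of the maximum *)

Local Open Scope nat_scope.

Definition peak_at (n : nat) (f : nat -> nat) (j : nat) : bool :=
  [&& 0 < j, j.+1 < n, f j.-1 < f j & f j.+1 < f j].

Definition insert_max (n : nat) (f : nat -> nat) (i j : nat) : nat :=
  if j < i then f j else if j == i then n else f j.-1.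

(** Slot [i] lies between the positions [i.-1] and [i]. A slot is quiet when
    inserting the maximum there keeps the number of peaks: it is an end of the
    sequence or is next to a peak. *)
Definition quiet_slot (n : nat) (f : nat -> nat) (i : nat) : bool :=
  [|| i == 0, i == n, peak_at n f i.-1 | peak_at n f i].

Lemma insert_max_gt (n : nat) (f : nat -> nat) (i j : nat) :
  i < j -> insert_max n f i j = f j.-1.
Proof. by move=> lij; rewrite /insert_max ltnNge (ltnW lij) gtn_eqF. Qed.

Lemma peak_at_big (n : nat) (f : nat -> nat) (m : nat) :
  n <= m.+1 -> peak_at n f m = false.
Proof. by move=> h; rewrite /peak_at [m.+1 < n]ltnNge h andbF. Qed.

Section Insertion.
Variables (n : nat) (f : nat -> nat).
Hypotheses (n_gt0 : 0 < n) (f_lt : forall j, j < n -> f j < n).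
Implicit Types i j m : nat.

Lemma peak_at_nonadj i : peak_at n f i -> peak_at n f i.+1 = false.
Proof.
case/and4P=> _ _ _ h; apply/negP=> /and4P[_ _ /= h' _].
by move: (ltn_trans h h'); rewrite ltnn.
Qed.

(** Two peaks are never adjacent, so the pairs of slots around the peaks are
    disjoint; they also avoid both ends. *)
Lemma sum_quiet_slot :
  \sum_(0 <= i < n.+1) quiet_slot n f i =
  2 + 2 * \sum_(0 <= j < n) peak_at n f j.
Proof.
have E i : 0 <= i < n.+1 -> nat_of_bool (quiet_slot n f i) =
    (i == 0) + (i == n) + (0 < i) * peak_at n f i.-1 + peak_at n f i.
  move=> _; case: i => [|i].
    by rewrite /quiet_slot /= /peak_at /= eq_sym (gtn_eqF n_gt0).
  rewrite /quiet_slot /= mul1n add0n.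
  have [Ein|ne] := eqVneq i.+1 n.
    by rewrite !peak_at_big // -Ein.
  case E: (peak_at n f i); first by rewrite (peak_at_nonadj E).
  by [].
rewrite (eq_big_nat _ _ E) !big_split /=.
have -> : \sum_(0 <= i < n.+1) (i == 0 : nat) = 1.
  by rewrite big_nat_recl // big1.
have -> : \sum_(0 <= i < n.+1) (i == n : nat) = 1.
  rewrite big_nat_recr //= eqxx big1_seq // => i.
  by rewrite mem_index_iota => /andP[_ /andP[_ /ltn_eqF ->]].
have -> : \sum_(0 <= i < n.+1) (0 < i) * peak_at n f i.-1 =
          \sum_(0 <= j < n) peak_at n f j.
  by rewrite big_nat_recl //; under eq_bigr do rewrite mul1n.
by rewrite big_nat_recr //= peak_at_big ?leqnSn // addn0 mul2n -addnn addnA.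
Qed.

Lemma peak_at_insert_lt i j : i < n -> j < i ->
  peak_at n.+1 (insert_max n f i.+1) j = peak_at n f j.
Proof.
move=> lin lji; rewrite /peak_at /insert_max.
by rewrite !ifT //; lia.
Qed.

Lemma peak_at_insert_gt i j : i.+1 < j ->
  peak_at n.+1 (insert_max n f i) j = peak_at n f j.-1.
Proof.
case: j => // -[|j] // lij; rewrite /peak_at !insert_max_gt //=; lia.
Qed.

Lemma peak_at_insert_eq i : i <= n ->
  peak_at n.+1 (insert_max n f i) i = (0 < i) && (i < n).
Proof.
move=> lin; rewrite /peak_at /insert_max ltnn eqxx ltnS.
case: i lin => //= i lin; rewrite leqnn.
case: (ltnP i.+1 n) => //= lin'; rewrite ifF ?gtn_eqF ?f_lt ?(ltnW lin') //.
by rewrite ltnNge leqnSn.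
Qed.

Lemma peak_at_insert_pred i : i < n ->
  peak_at n.+1 (insert_max n f i.+1) i = false.
Proof.
move=> lin; rewrite /peak_at /insert_max ltnn eqxx ltnSn.
by rewrite [n < f i]ltnNge (ltnW (f_lt lin)) !andbF.
Qed.

Lemma peak_at_insert_succ i : i <= n ->
  peak_at n.+1 (insert_max n f i) i.+1 = false.
Proof.
rewrite leq_eqVlt => /predU1P[->|lin]; first by rewrite peak_at_big.
rewrite /peak_at (@insert_max_gt _ _ i i.+1) // /insert_max /= ltnn eqxx.
by rewrite [n < f i]ltnNge (ltnW (f_lt lin)) /= andbF.
Qed.

(** The maximum becomes a peak unless it stands at an end, and it destroys the
    peak next to its slot if there is one; all other peaks survive. *)
Lemma sum_peak_insert i : i <= n ->
  \sum_(0 <= j < n.+1) peak_at n.+1 (insert_max n f i) j =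
  \sum_(0 <= j < n) peak_at n f j + ~~ quiet_slot n f i.
Proof.
move=> lin.
have -> : \sum_(0 <= j < n) peak_at n f j = \sum_(0 <= j < n.+1) peak_at n f j.
  by rewrite big_nat_recr //= peak_at_big ?leqnSn // addn0.
(* There is no peak at or beyond the last position; with one more index on each
   side, both sums split alike even when the slot is an end. *)
have -> : \sum_(0 <= j < n.+1) peak_at n.+1 (insert_max n f i) j =
          \sum_(0 <= j < n.+2) peak_at n.+1 (insert_max n f i) j.
  by rewrite [RHS]big_nat_recr //= peak_at_big ?addn0 ?leqnSn.
case: i lin => [|i] lin.
  rewrite /quiet_slot eqxx /= addn0 big_nat_recl // big_nat_recl //.
  rewrite peak_at_insert_eq // peak_at_insert_succ // !add0n.
  by rewrite [RHS]big_nat_recl.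
rewrite (big_cat_nat (n := i)) //=; last by lia.
rewrite [X in _ = X + _](big_cat_nat (n := i)) //=; last by lia.
rewrite (eq_big_nat _ _ (F2 := fun j => peak_at n f j : nat)); last first.
  by move=> j /andP[_ lji]; rewrite peak_at_insert_lt.
rewrite -!addnA; congr (_ + _).
rewrite big_ltn; last by lia.
rewrite big_ltn; last by lia.
rewrite [X in _ = X + _]big_ltn; last by lia.
rewrite peak_at_insert_pred // peak_at_insert_eq //= add0n.
rewrite big_ltn // [X in _ = _ + X + _]big_ltn // peak_at_insert_succ // add0n.
rewrite /quiet_slot /=.
have [E|ne] := eqVneq i.+1 n.
  by rewrite !peak_at_big -?E // ltnn !big_geq.
have -> /= : i.+1 < n by lia.
rewrite (@big_add1 _ _ _ i.+2 n.+2) /=.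
rewrite (eq_big_nat _ _ (F2 := fun j => peak_at n f j : nat)); last first.
  by move=> j /andP[lij _]; rewrite peak_at_insert_gt.
case E: (peak_at n f i); first by rewrite (peak_at_nonadj E) /=; lia.
by case: (peak_at n f i.+1) => /=; lia.
Qed.

End Insertion.

(** Permutations as functions on [nat], so that neighbouring positions are
    plain successors. *)
Definition ord_fun (n : nat) (s : 'S_n.+1) (j : nat) : nat := s (inord j).

Lemma ord_fun_lt (n : nat) (s : 'S_n.+1) (j : nat) : ord_fun s j < n.+1.
Proof. exact: ltn_ord. Qed.

Lemma ipk_sum_peak (n : nat) (s : 'S_n.+1) :
  ipk s = \sum_(0 <= j < n.+1) peak_at n.+1 (ord_fun s) j.
Proof.
rewrite /ipk big_mkord -sum1_card big_mkcond /=; apply: eq_bigr => i _.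
rewrite inE; have -> : peak_at n.+1 (ord_fun s) i =
    [exists j : 'I_n.+1, [exists k : 'I_n.+1,
      [&& i == j.+1 :> nat, k == i.+1 :> nat, s j < s i & s k < s i]]];
  last by case: [exists _, _].
apply/idP/existsP => [/and4P[i0 iN h1 h2]|[j /existsP[k]]].
  exists (inord i.-1); apply/existsP; exists (inord i.+1).
  rewrite !inordK ?prednK ?eqxx //=; last by have := ltn_ord i; lia.
  by move: h1 h2; rewrite /ord_fun inord_val => -> ->.
case/and4P=> /eqP Ej /eqP Ek h1 h2.
rewrite /peak_at /ord_fun inord_val -Ek ltn_ord.
by rewrite Ej /= !inord_val h1 h2.
Qed.

Lemma ord_fun_lift (n : nat) (s : 'S_n.+1) (i : 'I_n.+2) (j : nat) : j < n.+2 ->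
  ord_fun (lift_perm i ord_max s) j = insert_max n.+1 (ord_fun s) i j.
Proof.
move=> ltj; rewrite /ord_fun; case: (ltngtP j i) => lij.
- have ltj' : j < n.+1 by rewrite (leq_trans lij) // -ltnS.
  have -> : inord j = lift i (inord j : 'I_n.+1).
    by apply: val_inj; rewrite /= !inordK // /bump leqNgt lij.
  by rewrite lift_perm_lift /insert_max lij /= /bump leqNgt ltn_ord.
- have ltj' : j.-1 < n.+1 by case: j ltj lij.
  have -> : inord j = lift i (inord j.-1 : 'I_n.+1).
    apply: val_inj; rewrite /= !inordK // /bump; lia.
  by rewrite lift_perm_lift insert_max_gt //= /bump leqNgt ltn_ord.
- by rewrite lij inord_val lift_perm_id /insert_max ltnn eqxx.
Qed.

Lemma eq_peak_at (n : nat) (f g : nat -> nat) (j : nat) :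
  (forall i, i < n -> f i = g i) -> j < n -> peak_at n f j = peak_at n g j.
Proof.
move=> eqfg ltj; rewrite /peak_at; case: (ltnP j.+1 n) => // ltj'.
by rewrite !eqfg // (leq_ltn_trans (leq_pred j)).
Qed.

Lemma ipk_lift (n : nat) (s : 'S_n.+1) (i : 'I_n.+2) :
  ipk (lift_perm i ord_max s) = ipk s + ~~ quiet_slot n.+1 (ord_fun s) i.
Proof.
rewrite !ipk_sum_peak -sum_peak_insert //; last by rewrite -ltnS.
  apply: eq_big_nat => j /andP[_ ltj].
  by rewrite (eq_peak_at (@ord_fun_lift _ s i)).
by move=> j _; apply: ord_fun_lt.
Qed.

Lemma card_quiet_slot (n : nat) (s : 'S_n.+1) :
  #|[set i : 'I_n.+2 | quiet_slot n.+1 (ord_fun s) i]| = 2 + 2 * ipk s.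
Proof.
rewrite ipk_sum_peak -sum_quiet_slot // big_mkord -sum1_card big_mkcond /=.
by apply: eq_bigr => i _; rewrite inE; case: quiet_slot.
Qed.

(** Each peak accounts for two of the [n.+2] slots, the ends for two more. *)
Lemma double_ipk_le (n : nat) (s : 'S_n.+1) : 2 * ipk s <= n.
Proof.
rewrite -(leq_add2l 2) -card_quiet_slot -[leqRHS]card_ord; exact: max_card.
Qed.

Lemma sum_perm_lift (V : nmodType) (n : nat) (F : 'S_n.+1 -> V) :
  (\sum_s F s = \sum_s \sum_i F (lift_perm i ord_max s))%R.
Proof.
pose ins (p : 'I_n.+1 * 'S_n) := lift_perm p.1 ord_max p.2.
have ins_inj : injective ins.
  case=> [i s] [j t] /= E; have eqij : i = j.
    by apply: (@perm_inj _ (ins (j, t))); rewrite -{1}E !lift_perm_id.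
  rewrite -eqij in E *; congr (_, _); apply/permP=> k.
  apply: (@lift_inj _ ord_max); rewrite -!(lift_perm_lift i).
  by move: E; rewrite /ins /= => ->.
(* Surjectivity by counting: [n.+1] slots for each of [n`!] permutations. *)
have ins_bij : bijective ins.
  by apply: inj_card_bij => //; rewrite card_prod !card_Sn card_ord factS.
rewrite exchange_big pair_big (reindex ins) /=; last exact: onW_bij.
by apply: eq_bigr => p _.
Qed.

(** A permutation of [n.+2] letters arises from a unique permutation of [n.+1]
    letters by inserting the maximum; of the [n.+2] slots, [2 + 2 * ipk s] are
    quiet and the others add a peak. *)
Lemma sum_perm_insert (V : nmodType) (n : nat) (G : nat -> V) :
  (\sum_(s : 'S_n.+2) G (ipk s) =
   \sum_(s : 'S_n.+1) (G (ipk s) *+ (2 + 2 * ipk s) +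
                       G (ipk s).+1 *+ (n - 2 * ipk s)))%R.
Proof.
rewrite sum_perm_lift; apply: eq_bigr => s _.
pose Q := [set i : 'I_n.+2 | quiet_slot n.+1 (ord_fun s) i].
rewrite (bigID [in Q]) /=; congr (_ + _)%R.
  rewrite (eq_bigr (fun=> G (ipk s))).
    by rewrite sumr_const card_quiet_slot.
  by move=> i; rewrite ipk_lift inE => ->; rewrite addn0.
have <- : #|~: Q| = n - 2 * ipk s.
  by rewrite cardsCs finset.setCK card_quiet_slot card_ord; lia.
rewrite -sumr_const; apply: eq_big => [i|i]; first by rewrite finset.in_setC.
by rewrite ipk_lift inE => ->; rewrite addn1.
Qed.

(** * Derivations and two grammars *)

Local Open Scope ring_scope.

Definition derivation (A : comNzRingType) (D : A -> A) : Prop :=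
  (forall a b, D (a + b) = D a + D b) /\
  (forall a b, D (a * b) = D a * b + a * D b).

(** Repairs the exponent [n.-1] left by a derivative; at [n = 0] the multiple
    vanishes. *)
Lemma mul_expr_predMn (A : comNzRingType) (a b : A) n :
  a * (b * a ^+ n.-1 *+ n) = b * a ^+ n *+ n.
Proof. by case: n => [|n]; rewrite ?mulr0n ?mulr0 // mulrnAr mulrCA exprS. Qed.

Section Derivation.
Variables (A : comNzRingType) (D : A -> A).
Hypothesis derD : derivation D.

Lemma derivationD a b : D (a + b) = D a + D b.
Proof. exact: derD.1. Qed.

Lemma derivationM a b : D (a * b) = D a * b + a * D b.
Proof. exact: derD.2. Qed.

Lemma derivation0 : D 0 = 0.
Proof. by apply: (addrI (D 0)); rewrite -derivationD !addr0. Qed.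

Lemma derivationMn a n : D (a *+ n) = D a *+ n.
Proof.
by elim: n => [|n IH]; rewrite ?derivation0 // !mulrS derivationD IH.
Qed.

Lemma derivation1 : D 1 = 0.
Proof.
by apply: (addrI (D 1)); have := derivationM 1 1; rewrite !mulr1 mul1r addr0.
Qed.

Lemma derivation_sum (I : Type) (r : seq I) (P : pred I) (F : I -> A) :
  D (\sum_(i <- r | P i) F i) = \sum_(i <- r | P i) D (F i).
Proof. exact: (big_morph D derivationD derivation0). Qed.

Lemma derivationX a n : D (a ^+ n) = D a * a ^+ n.-1 *+ n.
Proof.
elim: n => [|n IH]; first by rewrite expr0 derivation1 mulr0n.
rewrite exprS derivationM IH mulrS /=; congr (_ + _).
exact: mul_expr_predMn.
Qed.

Lemma derivation_prod N (c : nat -> A) (e : nat -> nat) :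
  D (\prod_(j < N) c j ^+ e j) =
  \sum_(k < N) (D (c k) * \prod_(j < N) c j ^+ (e j - (j == k :> nat))) *+ e k.
Proof.
elim: N => [|N IH]; first by rewrite !big_ord0 derivation1.
rewrite big_ord_recr derivationM IH /= [RHS]big_ord_recr /=; congr (_ + _).
  rewrite mulr_suml; apply: eq_bigr => k _.
  by rewrite big_ord_recr /= gtn_eqF // subn0 mulrnAl mulrA.
rewrite big_ord_recr /= eqxx subn1 derivationX mulrnAr; congr (_ *+ _).
rewrite mulrCA; congr (_ * (_ * _)); apply: eq_bigr => j _.
by rewrite ltn_eqF // subn0.
Qed.

End Derivation.

Section PeakGrammar.
Variables (A : comNzRingType) (D : A -> A) (c s xi : A).
Hypotheses (derD : derivation D).
Hypotheses (Dc : D c = s) (Ds : D s = 2 * (c * xi) * s) (Dxi : D xi = 0).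

(** Let [d = c * xi], so that [D d = xi * s]. The monomial of a permutation with
    [j] peaks is [xi^j * s^(j+1) * d^(n-2j)]. Differentiating one of its
    [j + 1] factors [s] gives [2 d s]: the [2j + 2] quiet slots. Differentiating
    one of its [n - 2j] factors [d] gives [xi * s]: the slots which add a
    peak. *)
Lemma iter_derivation_peak n :
  iter n.+1 D c = \sum_(p : 'S_n.+1)
    xi ^+ ipk p * s ^+ (ipk p).+1 * (c * xi) ^+ (n - 2 * ipk p).
Proof.
elim: n => [|n IH].
  rewrite (eq_bigr (fun=> s)) => [|p _].
    by rewrite sumr_const card_Sn mulr1n -Dc.
  have := double_ipk_le p; rewrite leqn0 muln_eq0 /= => /eqP ->.
  by rewrite !mul1r mulr1.
rewrite iterS IH (derivation_sum derD).
rewrite (sum_perm_insert _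
  (fun j => xi ^+ j * s ^+ j.+1 * (c * xi) ^+ (n.+1 - 2 * j))).
apply: eq_bigr => p _; set j := ipk p.
have lej : (2 * j <= n)%N := double_ipk_le p.
have [m Em] : {m | n = (2 * j + m)%N} by exists (n - 2 * j)%N; rewrite subnKC.
have -> : (n.+1 - 2 * j)%N = m.+1 by lia.
have -> : (n.+1 - 2 * j.+1)%N = m.-1 by lia.
have -> : (n - 2 * j)%N = m by lia.
rewrite !(derivationM derD) !(derivationX derD) !(derivationM derD) Dc Dxi Ds.
rewrite !exprS /=.
case: m Em => [|m] Em; rewrite ?mulr0n /= ?exprS; ring.
Qed.
End PeakGrammar.

(** The coefficients of the polynomials given by [A_0 = 1] and
    [A_(n+1) = (2nX + 1) A_n - 2X(X - 1) A_n']. *)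
Fixpoint half_eul_coef (n k : nat) : nat :=
  if n is n'.+1 then
    ((1 + 2 * k) * half_eul_coef n' k +
     (if k is k'.+1 then 2 * (n' - k') * half_eul_coef n' k' else 0))%N
  else k == 0%N.

Lemma half_eul_coef_gt n k : (n < k)%N -> half_eul_coef n k = 0%N.
Proof.
elim: n k => [|n IH] [|k] //= ltnk.
by rewrite !IH ?muln0 // ltnW.
Qed.

(** One step of an operator which sends the [k]-th monomial of degree [n] to
    [1 + 2k] times the [k]-th and [2(n - k)] times the next monomial of degree
    [n + 1]. *)
Lemma sum_half_eul_coef (V : nmodType) n (m : nat -> V) :
  \sum_(k < n.+1)
    (m k *+ (1 + 2 * k) + m k.+1 *+ (2 * (n - k))) *+ half_eul_coef n k =
  \sum_(k < n.+2) m k *+ half_eul_coef n.+1 k.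
Proof.
under eq_bigr do rewrite mulrnDl -!mulrnA.
under [RHS]eq_bigr do rewrite /= mulrnDr.
rewrite !big_split /=; congr (_ + _).
  by rewrite [RHS]big_ord_recr /= half_eul_coef_gt // muln0 mulr0n addr0.
by rewrite [RHS]big_ord_recl /= mulr0n add0r.
Qed.

Section HalfEulerianGrammar.
Variables (A : comNzRingType) (D : A -> A) (c s xi : A).
Hypotheses (derD : derivation D).
Hypotheses (Dc : D c = s) (Ds : D s = 2 * (c * xi) * s) (Dxi : D xi = 0).

(** With [a = c * (c * xi)], the operator [c D] maps [c] to [c s] and both [a]
    and [s] to [2 a s]; hence it maps [c a^k s^m] to
    [(1 + 2k) c a^k s^(m+1) + 2m c a^(k+1) s^m]. *)
Lemma iter_mul_derivation_half_eul n :
  iter n (fun a => c * D a) c =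
  \sum_(k < n.+1) c * (c * (c * xi)) ^+ k * s ^+ (n - k) *+ half_eul_coef n k.
Proof.
elim: n => [|n IH]; first by rewrite big_ord1 /= !expr0 !mulr1.
rewrite iterS IH (derivation_sum derD) mulr_sumr.
rewrite -(@sum_half_eul_coef _ n
  (fun k => c * (c * (c * xi)) ^+ k * s ^+ (n.+1 - k))).
apply: eq_bigr => k _; rewrite (derivationMn derD) mulrnAr; congr (_ *+ _).
have lekn : (k <= n)%N by rewrite -ltnS.
rewrite subSS subSn //; set m := (n - k)%N; set a := c * (c * xi).
have DXk : c * D (a ^+ k) = 2 * s * a ^+ k *+ k.
  rewrite -mul_expr_predMn (derivationX derD) !mulrnAr; congr (_ *+ _).
  by rewrite /a !(derivationM derD) Dc Dxi; ring.
have Dsm : D (s ^+ m) = 2 * (c * xi) * s ^+ m *+ m.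
  rewrite -mul_expr_predMn (derivationX derD) Ds mulrnAr.
  by congr (_ *+ _); ring.
rewrite !(derivationM derD) Dc Dsm.
transitivity (c * (s * a ^+ k) * s ^+ m + c * (c * D (a ^+ k)) * s ^+ m
    + c * (c * a ^+ k * (2 * (c * xi) * s ^+ m *+ m))); first by ring.
rewrite DXk !exprS /a; ring.
Qed.
End HalfEulerianGrammar.

(** * Ballot words and the expansion of (cD)^n c *)

Local Open Scope nat_scope.

(** The letters of a word are the columns, from 0, of the entries of a tableau
    in increasing order. Then [col_mult w k] counts the rows of length [k]. For
    [k = 0] these are the rows still unused in a reserve that starts with one
    empty row and gains one with each entry. *)
Definition col_mult (w : seq nat) (k : nat) : nat :=
  if k is k'.+1 then count_mem k' w - count_mem k'.+1 w
  else (size w).+1 - count_mem 0 w.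

(** The factor of a letter is the number of rows to which it can be added, the
    box sorting index of the corresponding entry. *)
Definition word_weight (w : seq nat) : nat :=
  \prod_(m < size w) col_mult (take m w) (nth 0 w m).

(** The lattice (Yamanouchi) condition: every letter finds a row to extend. *)
Definition ballot (w : seq nat) : bool :=
  [forall m : 'I_(size w), 0 < col_mult (take m w) (nth 0 w m)].

Fixpoint ballot_words (n : nat) : seq (seq nat) :=
  if n is n'.+1 then
    [seq rcons w k | w <- ballot_words n',
                     k <- [seq k <- iota 0 n'.+1 | 0 < col_mult w k]]
  else [:: [::]].

Lemma word_weight_rcons w k :
  word_weight (rcons w k) = word_weight w * col_mult w k.
Proof.
rewrite /word_weight size_rcons big_ord_recr /= -cats1 take_size_cat //.
rewrite nth_cat ltnn subnn; congr (_ * _); apply: eq_bigr => m _.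
by rewrite nth_cat ltn_ord takel_cat // ltnW.
Qed.

Lemma ballotP w :
  reflect (forall m, m < size w -> 0 < col_mult (take m w) (nth 0 w m))
          (ballot w).
Proof.
apply: (iffP forallP) => [H m ltm|H m]; last exact: H.
exact: (H (Ordinal ltm)).
Qed.

Lemma ballot_rcons w k : ballot (rcons w k) = ballot w && (0 < col_mult w k).
Proof.
apply/ballotP/andP => [H|[/ballotP H Hk] m].
  split; last first.
    have := H (size w).
    rewrite size_rcons ltnSn -cats1 take_size_cat // nth_cat.
    by rewrite ltnn subnn; apply.
  apply/ballotP => m ltm; have := H m.
  rewrite size_rcons ltnS ltnW // => /(_ isT).
  by rewrite -cats1 nth_cat ltm takel_cat // ltnW.
rewrite size_rcons ltnS leq_eqVlt => /predU1P[->|ltm].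
  by rewrite -cats1 take_size_cat // nth_cat ltnn subnn.
by rewrite -cats1 nth_cat ltm takel_cat ?H // ltnW.
Qed.

Lemma count_rcons (T : Type) (a : pred T) (s : seq T) x :
  count a (rcons s x) = count a s + a x.
Proof. by rewrite -cats1 count_cat /= addn0. Qed.

Lemma ballot_count_le w k : ballot w -> count_mem k.+1 w <= count_mem k w.
Proof.
elim/last_ind: w => [//|w j IH]; rewrite ballot_rcons => /andP[/IH le_k].
rewrite !count_rcons /=; case: j => [|j] /=.
  by rewrite addn0 (leq_trans le_k) // leq_addr.
rewrite eqSS subn_gt0; have [->|_] := eqVneq j k => [lt_k|_].
  by rewrite addn1 (leq_trans lt_k) // leq_addr.
by rewrite addn0 (leq_trans le_k) // leq_addr.
Qed.

Lemma ballot_count_homo w i j :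
  ballot w -> i <= j -> count_mem j w <= count_mem i w.
Proof.
move=> bw; elim: j => [|j IH]; first by rewrite leqn0 => /eqP ->.
rewrite leq_eqVlt => /predU1P[->//|/IH]; apply: leq_trans.
exact: ballot_count_le.
Qed.

(** A column can only be entered after the previous one, so a letter [k] needs
    [k] letters before it. *)
Lemma ballot_lt w k : ballot w -> k \in w -> k < size w.
Proof.
elim/last_ind: w k => [//|w j IH] k; rewrite ballot_rcons => /andP[bw mj].
rewrite mem_rcons size_rcons ltnS inE => /predU1P[->|/(IH _ bw)/ltnW//].
case: j mj => [//|j] /=; rewrite subn_gt0 => /(leq_ltn_trans (leq0n _)).
by rewrite -has_count has_pred1 => /(IH _ bw).
Qed.

Lemma ballot_mult_gt w k : ballot w -> size w < k -> col_mult w k = 0.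
Proof.
case: k => [//|k] bw; rewrite ltnS => lek /=; rewrite (count_memPn _) //.
by apply/negP => /(ballot_lt bw); rewrite ltnNge lek.
Qed.

(** Adding an entry in column [k] turns a row of length [k] into a row of length
    [k.+1] and puts a new empty row in the reserve. *)
Lemma col_mult_rcons w k j : ballot w -> 0 < col_mult w k ->
  col_mult (rcons w k) j = col_mult w j - (j == k) + (j == 0) + (j == k.+1).
Proof.
move=> bw; case: j => [|j]; rewrite /= ?size_rcons !count_rcons /=.
  have := count_size (pred1 0) w; move: (count _ w) (size w) => x y lexy _.
  by case: k => [|k] /=; lia.
rewrite !eqSS eq_sym addn0; have := ballot_count_le j bw.
have [->|_] := eqVneq k j.+1.
  rewrite /= -[j == _]/(j == j.+1) ltn_eqF // subn_gt0.
  by move: (count _ w) (count _ w) => x y; lia.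
by move=> le_j _; rewrite addn0 subn0 addnBAC.
Qed.

Arguments col_mult : simpl never.

Lemma mem_ballot_words n w : (w \in ballot_words n) = (size w == n) && ballot w.
Proof.
elim: n w => [|n IH] w.
  by rewrite inE; case: w => //=; apply/esym/ballotP.
apply/allpairsPdep/andP => [[v [k [+ + ->]]]|[/eqP]].
  rewrite IH mem_filter => /andP[/eqP <- bv] /andP[mk _].
  by rewrite size_rcons ballot_rcons bv mk.
case/lastP: w => [//|v k].
rewrite size_rcons ballot_rcons => -[sv] /andP[bv mk].
exists v, k; rewrite IH bv sv eqxx mem_filter mk mem_iota; split=> //=.
rewrite add0n leqNgt -sv; apply/negP => /(ballot_mult_gt bv) E.
by rewrite E in mk.
Qed.

Lemma uniq_ballot_words n : uniq (ballot_words n).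
Proof.
elim: n => [//|n IH]; apply: allpairs_uniq_dep => //.
  by move=> w _; rewrite filter_uniq // iota_uniq.
by case=> [v k] [w j] _ _ /= /rcons_inj[-> ->].
Qed.

Local Open Scope ring_scope.

Section NormalOrdering.
Variables (A : comNzRingType) (D : A -> A) (c : A).
Hypothesis derD : derivation D.

(** By [derivation_prod], [c D] replaces one of the [col_mult w k] factors
    [D^k c] by [D^(k+1) c] and adds a factor [c]. This is the effect of the
    letter [k] on the multiplicities, by [col_mult_rcons]. *)
Lemma iter_mul_derivation n :
  iter n (fun a => c * D a) c =
  \sum_(w <- ballot_words n)
     (\prod_(k < n.+1) iter k D c ^+ col_mult w k) *+ word_weight w.
Proof.
elim: n => [|n IH].
  by rewrite big_seq1 big_ord1 /word_weight /col_mult /= big_ord0 subn0 expr1.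
rewrite iterS IH (derivation_sum derD) mulr_sumr big_allpairs_dep.
apply: eq_big_seq => w; rewrite mem_ballot_words => /andP[/eqP sw bw].
rewrite (derivationMn derD) (derivation_prod derD _ (fun k => iter k D c)).
rewrite big_filter -[iota 0 n.+1]/(index_iota 0 n.+1) big_mkord.
rewrite [RHS]big_mkcond /= mulrnAr -mulrnAl mulr_sumr.
apply: eq_bigr => k _; case: ifPn => [mk|]; last first.
  by rewrite -eqn0Ngt => /eqP ->; rewrite mulr0n mulr0.
rewrite word_weight_rcons mulnC mulrnA mulrnAl mulrnAr; congr (_ *+ _ *+ _).
transitivity (\prod_(j < n.+2) iter j D c ^+ (col_mult w j - (j == k :> nat)) *
   \prod_(j < n.+2) iter j D c ^+ (j == 0 :> nat) *
   \prod_(j < n.+2) iter j D c ^+ (j == k.+1 :> nat)); last first.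
  rewrite -!big_split; apply: eq_bigr => j _.
  by rewrite /= col_mult_rcons // !exprD.
have pick i : (i < n.+2)%N ->
    \prod_(j < n.+2) iter j D c ^+ (j == i :> nat) = iter i D c.
  move=> lti; rewrite (bigD1 (Ordinal lti)) //= eqxx expr1 big1 ?mulr1 // => j.
  by rewrite -val_eqE /= => /negbTE ->; rewrite expr0.
rewrite (pick 0%N) // (pick k.+1 (ltn_ord k)).
rewrite [X in _ = X * _ * _]big_ord_recr /= ballot_mult_gt ?sw // sub0n expr0.
by ring.
Qed.

End NormalOrdering.

(** * The 1/2-Eulerian polynomials *)

Local Open Scope ring_scope.

Definition half_eul_poly (R : nzSemiRingType) (n : nat) : {poly R} :=
  \poly_(k < n.+1) (half_eul_coef n k)%:R.

Lemma horner_half_eul_poly (R : nzSemiRingType) (n : nat) (x : R) :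
  (half_eul_poly R n).[x] = \sum_(k < n.+1) x ^+ k *+ half_eul_coef n k.
Proof.
by rewrite horner_poly; apply: eq_bigr => k _; rewrite mulr_natl.
Qed.

Section Calculus.
Variable R : realType.
Implicit Types x : R.

Lemma is_derive_one_minus x : is_derive x 1 (fun y : R => 1 - y) (-1).
Proof.
have := is_deriveB (is_derive_cst (1 : R) x 1) (is_derive_id x 1).
by rewrite sub0r; apply.
Qed.

Lemma is_derive_inv_sqrt x : x < 1 ->
  is_derive x 1 (@inv_sqrt_one_minus R)
    (inv_sqrt_one_minus x * (1 - x)^-1 / 2).
Proof.
move=> x1; have x0 : 0 < 1 - x by rewrite subr_gt0.
have d2 := @is_derive1_comp _ _ (fun y : R => 1 - y) _ _ _
  (is_derive1_sqrt x0) (is_derive_one_minus x).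
have s0 : Num.sqrt (1 - x) != 0 by rewrite gt_eqF // sqrtr_gt0.
have := @is_deriveV R (Num.sqrt \o (fun y : R => 1 - y)) x _ 1 s0 d2.
move=> d3; apply: (is_derive_eq d3); rewrite /inv_sqrt_one_minus /=.
rewrite /GRing.scale /= -[in X in _ = _ * X^-1 / _](sqr_sqrtr (ltW x0)).
by field.
Qed.

(** Put [u = 1 / (1 - x)] and [s = x / (1 - x)]. Then [2 x d/dx] maps
    [1 / sqrt (1 - x)] to [s] times itself, and maps [u] and [s = u - 1] to
    [2 u s]: the rules of [iter_mul_derivation_half_eul]. *)
Lemma iter_two_x_ddx n x : x < 1 ->
  iter n (@two_x_ddx R) (@inv_sqrt_one_minus R) x =
  \sum_(k < n.+1) inv_sqrt_one_minus x * (1 - x)^-1 ^+ k *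
     (x * (1 - x)^-1) ^+ (n - k) *+ half_eul_coef n k.
Proof.
elim: n x => [|n IH] x x1; first by rewrite big_ord1 /= !expr0 !mulr1.
pose g := @inv_sqrt_one_minus R.
pose u (y : R) := (1 - y)^-1.
pose s (y : R) := y * u y.
rewrite iterS /two_x_ddx derive1E -/(@two_x_ddx R).
pose h (k : 'I_n.+1) : R -> R :=
  (half_eul_coef n k)%:R \*: (g * u ^+ k * s ^+ (n - k)).
have -> : 'D_1 (iter n (@two_x_ddx R) (@inv_sqrt_one_minus R)) x =
          'D_1 (\sum_(k < n.+1) h k) x.
  apply: near_eq_derive; near=> y; rewrite IH; last by near: y; exact: lt_nbhsl.
  by rewrite fct_sumE; apply: eq_bigr => k _; rewrite /h -mulr_natl /= !fctE.
have x0 : 1 - x != 0 by rewrite subr_eq0 gt_eqF.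
have du : is_derive x 1 u (u x ^+ 2).
  have d := @is_deriveV R _ x _ 1 x0 (is_derive_one_minus x).
  apply: (is_derive_eq d).
  by rewrite /GRing.scale /= mulrN1 opprK /u exprVn.
have ds : is_derive x 1 s (u x * s x + u x).
  have d := is_deriveM (is_derive_id x 1) du; apply: (is_derive_eq d).
  by rewrite /GRing.scale /= /s; ring.
have dg := is_derive_inv_sqrt x1.
(* Since [s x + 1 = u x]. *)
have us : u x * s x + u x = u x * u x by rewrite /s /u; field.
have dh k : is_derive x 1 (h k) ((half_eul_coef n k)%:R *
   (g x * (u x ^+ k * s x ^+ (n - k)) *
     (u x / 2 + k%:R * u x) +
    g x * u x ^+ k * (u x * u x * s x ^+ (n - k).-1 *+ (n - k)))).
  have d := is_deriveZ (half_eul_coef n k)%:R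
    (is_deriveM (is_deriveM dg (is_deriveX k du)) (is_deriveX (n - k) ds)).
  apply: (is_derive_eq d); congr (_ * _).
  rewrite mulrfctE !exprfctE.
  change (g x * u x ^+ k *
      ((n - k)%:R * s x ^+ (n - k).-1 * (u x * s x + u x)) +
    s x ^+ (n - k) * (g x * (k%:R * u x ^+ k.-1 * u x ^+ 2) +
                      u x ^+ k * (g x * u x / 2)) =
    g x * (u x ^+ k * s x ^+ (n - k)) * (u x / 2 + k%:R * u x) +
    g x * u x ^+ k * (u x * u x * s x ^+ (n - k).-1 *+ (n - k))).
  have Ek : k%:R * u x ^+ k.-1 * u x ^+ 2 = k%:R * u x * u x ^+ k.
    by case: (k : nat) => [|j]; rewrite ?mul0r //= !exprS; ring.
  by rewrite Ek us -mulr_natl; ring.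
have -> := @derive_val _ _ _ _ _ _ _ (is_derive_sum dh).
rewrite mulr_sumr -(@sum_half_eul_coef _ n
  (fun k => g x * u x ^+ k * s x ^+ (n.+1 - k))).
apply: eq_bigr => k _.
have lekn : (k <= n)%N by rewrite -ltnS.
rewrite subSS subSn // -[RHS]mulr_natl mulrCA; congr (_ * _).
set m := (n - k)%N.
transitivity (g x * u x ^+ k * s x ^+ m * (s x * (1 + 2 * k%:R)) +
  2 * g x * u x ^+ k * (s x * (u x * s x ^+ m.-1 *+ m))).
  by have sx : s x = x * u x by []; rewrite sx; field.
by rewrite mul_expr_predMn !exprS; ring.
Unshelve. all: by end_near.
Qed.

End Calculus.

Lemma is_half_eulerian_poly (R : realType) (n : nat) :
  is_half_eulerian n (half_eul_poly R n).
Proof.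
move=> x xN0 x1; have x0 : 0 < 1 - x by rewrite subr_gt0.
have powE : (1 - x) `^ (n%:R + 2^-1) = (1 - x) ^+ n * Num.sqrt (1 - x).
  rewrite powRD ?(gt_eqF x0) ?implybT // powR_mulrn ?(ltW x0) //.
  by rewrite powR12_sqrt // ltW.
rewrite iter_two_x_ddx // horner_half_eul_poly mulr_sumr mulr_suml.
apply: eq_bigr => k _; rewrite mulrnAr mulrnAl; congr (_ *+ _).
have expn (a : R) : a ^+ n = a ^+ (n - k) * a ^+ k.
  by rewrite -exprD subnK // -ltnS.
rewrite powE /inv_sqrt_one_minus exprMn !expn !exprVn.
have xk0 : x ^+ k != 0 by rewrite expf_neq0.
have yk0 : (1 - x) ^+ k != 0 by rewrite expf_neq0 // gt_eqF.
have s0 : Num.sqrt (1 - x) != 0 by rewrite gt_eqF // sqrtr_gt0.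
have ym0 : (1 - x) ^+ (n - k) != 0 by rewrite expf_neq0 // gt_eqF.
by field; rewrite ?xk0 ?yk0 ?s0 ?ym0.
Qed.

(** The factors of the polynomial in the defining identity do not vanish, so its
    values at all negative points are determined. *)
Lemma is_half_eulerian_unique (R : realType) (n : nat) (A B : {poly R}) :
  is_half_eulerian n A -> is_half_eulerian n B -> A = B.
Proof.
move=> hA hB; apply/eqP; rewrite -subr_eq0.
pose rs : seq R := [seq - k.+1%:R | k <- iota 0 (size (A - B))].
apply/eqP/(@roots_geq_poly_eq0 _ _ rs); last by rewrite size_map size_iota.
  apply/allP => _ /mapP[k _ ->]; rewrite rootE hornerD hornerN subr_eq0.
  set y : R := - k.+1%:R; have y0 : y < 0 by rewrite oppr_lt0 ltr0n.
  have yN0 : y^-1 != 0 by rewrite invr_eq0 lt_eqF.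
  have y1 : y^-1 < 1 by rewrite (lt_trans _ ltr01) // invr_lt0.
  have pow0 : ((1 - y^-1) `^ (n%:R + 2^-1))^-1 != 0.
    by rewrite invr_eq0 gt_eqF // powR_gt0 // subr_gt0.
  have := hA _ yN0 y1; rewrite (hB _ yN0 y1) invrK => /(mulIf pow0).
  by move/(mulfI (expf_neq0 n yN0)) => ->.
rewrite map_inj_uniq ?iota_uniq // => i j /oppr_inj/eqP.
by rewrite eqr_nat => /eqP[].
Qed.

Lemma half_eulerianE (R : realType) (n : nat) :
  half_eulerian R n = half_eul_poly R n.
Proof.
apply: (@is_half_eulerian_unique _ n); last exact: is_half_eulerian_poly.
apply: (@xgetPex _ 0 (fun A : {poly R} => is_half_eulerian n A)).
by exists (half_eul_poly R n); exact: is_half_eulerian_poly.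
Qed.

(** * The Riccati derivation *)

Section Riccati.
Variables (F : fieldType) (x : F).
Hypothesis x0 : x != 0.

(** The exponential generating function [y] of the interior peak polynomials at
    [1/x] satisfies [y' = 1 + 2y + y^2 / x], so [c = x + y] satisfies
    [c' = c^2 / x + 1 - x]. *)
Definition riccati_rhs : {poly F} := x^-1 *: 'X^2 + (1 - x)%:P.

Definition riccati_deriv (p : {poly F}) : {poly F} := p^`() * riccati_rhs.

Lemma derivation_riccati_deriv : derivation riccati_deriv.
Proof.
by split=> p q; rewrite /riccati_deriv (derivD, derivM) mulrDl //; ring.
Qed.

Lemma riccati_derivX : riccati_deriv 'X = riccati_rhs.
Proof. by rewrite /riccati_deriv derivX mul1r. Qed.

Lemma riccati_derivC a : riccati_deriv a%:P = 0.
Proof. by rewrite /riccati_deriv derivC mul0r. Qed.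

Lemma riccati_deriv_rhs :
  riccati_deriv riccati_rhs = 2 * ('X * x^-1%:P) * riccati_rhs.
Proof.
rewrite {1}/riccati_deriv {1}/riccati_rhs derivD derivC addr0 derivZ derivXn.
by congr (_ * _); rewrite -mul_polyC /=; ring.
Qed.

Lemma horner_riccati_rhs : riccati_rhs.[x] = 1.
Proof.
by rewrite /riccati_rhs hornerD hornerZ hornerXn hornerC expr2 mulKf // subrKC.
Qed.

Lemma horner_iter_mul_riccati_deriv n :
  (iter n (fun p => 'X * riccati_deriv p) 'X).[x] = x * (half_eul_poly F n).[x].
Proof.
rewrite (iter_mul_derivation_half_eul derivation_riccati_deriv riccati_derivX
  riccati_deriv_rhs (riccati_derivC _)).
rewrite horner_half_eul_poly horner_sum mulr_sumr.
apply: eq_bigr => k _; rewrite hornerMn mulrnAr; congr (_ *+ _).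
rewrite !hornerM !horner_exp horner_riccati_rhs expr1n mulr1.
by rewrite !hornerM hornerX hornerC mulfV // mulr1.
Qed.

End Riccati.

(** In [iter_derivation_peak], both [s] and [d] take the value 1 at [c = x], so
    only the power of [xi = x^-1] remains of each monomial. *)
Lemma horner_iter_riccati_deriv (R : realType) (x : R) (x0 : x != 0) n :
  (iter n.+1 (riccati_deriv x) 'X).[x] = (peak_poly R n.+1).[x^-1].
Proof.
rewrite (iter_derivation_peak (derivation_riccati_deriv x) (riccati_derivX x)
  (riccati_deriv_rhs x) (riccati_derivC _ _)) !horner_sum.
apply: eq_bigr => p _.
rewrite !hornerM !horner_exp horner_riccati_rhs // !expr1n.
by rewrite hornerM !hornerX !hornerC mulfV // expr1n !mulr1.
Qed.

(** * Standard Young tableaux as ballot words *)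

Local Open Scope nat_scope.

Lemma count_takeS (w : seq nat) (k m : nat) : m < size w ->
  count_mem k (take m.+1 w) = count_mem k (take m w) + (nth 0 w m == k).
Proof. by move=> ltm; rewrite (take_nth 0 ltm) count_rcons. Qed.

Lemma count_take_le (w : seq nat) (k i j : nat) : i <= j ->
  count_mem k (take i w) <= count_mem k (take j w).
Proof.
move=> leij; have -> : take i w = take i (take j w) by rewrite take_takel.
by rewrite -{2}[take j w](cat_take_drop i) count_cat leq_addr.
Qed.

Lemma count_take_lt (w : seq nat) (i j : nat) : i < j -> i < size w ->
  count_mem (nth 0 w i) (take i w) < count_mem (nth 0 w i) (take j w).
Proof.
move=> ltij lti; apply: leq_trans (count_take_le w _ ltij).
by rewrite count_takeS // eqxx addn1.
Qed.

Lemma occurrence (w : seq nat) (k r : nat) : r < count_mem k w ->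
  exists2 m, m < size w & nth 0 w m = k /\ count_mem k (take m w) = r.
Proof.
elim/last_ind: w => [//|w j IH]; rewrite count_rcons.
have [ltr _|ler] := ltnP r (count_mem k w).
  have [m ltm [<- <-]] := IH ltr; exists m; first by rewrite size_rcons ltnW.
  by rewrite -cats1 nth_cat ltm takel_cat ?(ltnW ltm).
rewrite /=; have [->|_] := eqVneq j k; last by rewrite addn0 ltnNge ler.
rewrite addn1 ltnS => ler'; exists (size w); rewrite ?size_rcons //.
rewrite -cats1 nth_cat ltnn subnn take_size_cat //; split=> //.
by apply/eqP; rewrite eqn_leq ler ler'.
Qed.

Lemma ballot_take (w : seq nat) (i : nat) : ballot w -> ballot (take i w).
Proof.
move=> /ballotP bw; apply/ballotP => m.
rewrite size_take_min leq_min => /andP[lti ltw].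
by rewrite nth_take // take_takel ?bw // ltnW.
Qed.

Lemma sum_count_mem (w : seq nat) (n : nat) : (forall k, k \in w -> k < n) ->
  \sum_(k < n) count_mem (k : nat) w = size w.
Proof.
elim: w => [|j w IH] ltw; first by rewrite big1.
rewrite big_split /= IH => [|k kw]; last by rewrite ltw // inE kw orbT.
have ltj : j < n by rewrite ltw // mem_head.
rewrite (bigD1 (Ordinal ltj)) //= eqxx big1 // => k.
by rewrite -val_eqE /= eq_sym => /negbTE ->.
Qed.

Lemma card_ord_lt (n i : nat) : i <= n -> #|[set k : 'I_n | k < i]| = i.
Proof.
move=> lein; rewrite -sum1_card -[RHS]card_ord -sum1_card.
rewrite (big_ord_widen n (fun=> 1) lein).
by apply: eq_bigl => k; rewrite inE.
Qed.

(** A down-closed set of ordinals is an initial segment. *)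
Lemma card_ord_down (n : nat) (p : pred 'I_n) (k : 'I_n) :
  (forall i j : 'I_n, i <= j -> p j -> p i) -> (k < #|[set i | p i]|) = p k.
Proof.
move=> down; apply/idP/idP => [|pk].
  apply: contraLR => pNk; rewrite -leqNgt.
  rewrite -[leqRHS](card_ord_lt (ltnW (ltn_ord k))).
  apply/subset_leq_card/fintype.subsetP => i.
  rewrite !inE ltnNge => pi.
  by apply: contra pNk => leki; apply: down pi.
rewrite -[leqLHS](card_ord_lt (ltn_ord k)).
apply/subset_leq_card/fintype.subsetP => i; rewrite !inE ltnS => leik.
exact: down pk.
Qed.

Lemma eq_box (n : nat) (c d : 'I_n * 'I_n) :
  c.1 = d.1 :> nat -> c.2 = d.2 :> nat -> c = d.
Proof. by case: c d => [i j] [k l] /= /val_inj -> /val_inj ->. Qed.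

Definition col_word (n : nat) (T : {ffun 'I_n -> 'I_n * 'I_n}) : seq nat :=
  [seq nat_of_ord (T m).2 | m <- enum 'I_n].

Section ColWord.
Variables (n : nat) (T : {ffun 'I_n -> 'I_n * 'I_n}).
Local Notation w := (col_word T).

Lemma size_col_word : size w = n.
Proof. by rewrite size_map size_enum_ord. Qed.

Lemma nth_col_word (m : 'I_n) : nth 0 w m = (T m).2.
Proof. by rewrite (nth_map m) ?size_enum_ord // nth_ord_enum. Qed.

Lemma col_lenE (i k : nat) : i <= n -> col_len T i k = count_mem k (take i w).
Proof.
move=> lein; rewrite /col_len -sum1_card.
under eq_bigl do rewrite inE.
rewrite big_mkcondr /=.
under eq_bigr => m _ do rewrite -nth_col_word.
rewrite -(big_ord_widen n (fun m => if nth 0 w m == k then 1 else 0) lein).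
elim: i lein => [|i IH] lein; first by rewrite big_ord0 take0.
by rewrite big_ord_recr IH ?(ltnW lein) // count_takeS ?size_col_word.
Qed.

Hypothesis TS : T \in SYT n.

Lemma SYT_inj : injective T.
Proof. by move: TS; rewrite inE => /and4P[/injectiveP]. Qed.

Lemma SYT_shape : exists lam : {ffun 'I_n -> 'I_n.+1},
  is_partition lam /\
  forall c : 'I_n * 'I_n, c.2 < lam c.1 <-> exists m, T m = c.
Proof.
move: TS; rewrite inE => /and4P[_ /existsP[lam /andP[plam /eqP E]] _ _].
exists lam; split=> // c.
have -> : (c.2 < lam c.1) = (c \in [set T m | m : 'I_n]).
  by rewrite E inE.
by split=> [/imsetP[m _ ->]|[m <-]]; [exists m | apply: imset_f].
Qed.

Lemma SYT_row (a b : 'I_n) : (T a).1 = (T b).1 -> (T a).2 < (T b).2 -> a < b.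
Proof.
move: TS; rewrite inE => /and4P[_ _ /forallP/(_ a)/forallP/(_ b)/implyP H _].
move=> E lt.
by apply: H; rewrite E eqxx.
Qed.

Lemma SYT_col (a b : 'I_n) : (T a).2 = (T b).2 -> (T a).1 < (T b).1 -> a < b.
Proof.
move: TS; rewrite inE => /and4P[_ _ _ /forallP/(_ a)/forallP/(_ b)/implyP H].
move=> E lt.
by apply: H; rewrite E eqxx.
Qed.

Lemma SYT_down (m : 'I_n) (r k : 'I_n) : r <= (T m).1 -> k <= (T m).2 ->
  exists m', T m' = (r, k).
Proof.
have [lam [/andP[/forallP dec _] lamP]] := SYT_shape.
move=> ler lek; apply/lamP => /=; apply: leq_ltn_trans lek _.
apply: leq_trans (_ : lam (T m).1 <= _); first by apply/lamP; exists m.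
by have /forallP/(_ (T m).1)/implyP := dec r; apply.
Qed.

(** The entries below [m] in its column are those which precede it there, so the
    column word determines the rows as well. *)
Lemma SYT_rowE (m : 'I_n) :
  (T m).1 = count_mem (nat_of_ord (T m).2) (take m w) :> nat.
Proof.
rewrite -col_lenE 1?ltnW // /col_len.
rewrite -[LHS](@card_ord_lt n) 1?ltnW //.
set S := [set _ | _]; set S' := [set _ | _].
have -> : S = [set (T m').1 | m' in S'].
  apply/setP => r; rewrite inE; apply/idP/imsetP => [ltr|[m' + ->]].
    have [m' Em'] := SYT_down (ltnW ltr) (leqnn (T m).2).
    exists m'; last by rewrite Em'.
    by rewrite inE (@SYT_col m' m) ?Em' //=.
  rewrite inE => /andP[ltm /eqP E]; rewrite ltnNge leq_eqVlt; apply/negP.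
  case/predU1P => [Er|/SYT_col lt]; last first.
    by have := lt (esym (val_inj E)); rewrite ltnNge (ltnW ltm).
  by move: ltm; rewrite (SYT_inj (eq_box Er (esym E))) ltnn.
rewrite card_in_imset // => a b.
rewrite !inE => /andP[_ /eqP Ea] /andP[_ /eqP Eb] E.
by apply: SYT_inj; apply: eq_box; rewrite ?E // Ea Eb.
Qed.

(** The left neighbour of an entry in column [k.+1] and row [r] precedes it,
    hence column [k] has more than [r] entries by then, and column [k.+1] has
    exactly [r]. *)
Lemma ballot_col_word : ballot w.
Proof.
apply/ballotP => m; rewrite size_col_word => ltm.
pose m' := Ordinal ltm; rewrite -[m]/(nat_of_ord m') nth_col_word.
have := SYT_rowE m'; case E : (nat_of_ord (T m').2) => [|k] Er.
  by rewrite /col_mult subn_gt0 ltnS count_size.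
have ltk : k < n by rewrite ltnW // -E.
have := @SYT_down m' (T m').1 (Ordinal ltk) (leqnn _); rewrite /= E leqnSn.
case=> // a Ea; have lta : a < m' by apply: SYT_row; rewrite Ea //= E.
rewrite /col_mult subn_gt0 -Er; have := SYT_rowE a; rewrite Ea /= => ->.
have := @count_take_lt w a m' lta; rewrite nth_col_word Ea /=; apply.
by rewrite size_col_word.
Qed.

(** Column [i] meets exactly the rows of length greater than [i]. *)
Lemma card_rows_longer (i : nat) :
  #|[set r : 'I_n | i < row_len T r]| = count_mem i w.
Proof.
have [lam [_ lamP]] := SYT_shape.
have row_lenE r : row_len T r = lam r.
  rewrite /row_len -[RHS](@card_ord_lt n) -1?ltnS //.
  rewrite -(card_in_imset (f := fun m => (T m).2)); last first.
    move=> a b; rewrite !inE => /eqP Ea /eqP Eb E; apply: SYT_inj.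
    by apply: eq_box; rewrite ?E // Ea Eb.
  congr #|pred_of_set _|; apply/setP => k; rewrite !inE.
  apply/imsetP/idP => [[m]|/(lamP (r, k))[m Em]].
    by rewrite inE => /eqP <- ->; apply/lamP; exists m.
  by exists m; rewrite ?inE Em.
have -> : count_mem i w = col_len T n i.
  by rewrite col_lenE // take_oversize // size_col_word.
rewrite /col_len -[RHS](card_in_imset (f := fun m => (T m).1)); last first.
  move=> a b; rewrite !inE => /andP[_ /eqP Ea] /andP[_ /eqP Eb] E.
  by apply: SYT_inj; apply: eq_box; rewrite ?E // Ea Eb.
congr #|pred_of_set _|; apply/setP => r; rewrite !inE row_lenE.
apply/idP/imsetP => [lti|[m]].
  have ltin : i < n by apply: leq_trans lti _; rewrite -ltnS.
  have /(lamP (r, Ordinal ltin))[m Em] := lti.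
  by exists m; rewrite ?inE Em //= ltn_ord eqxx.
by rewrite inE => /andP[_ /eqP <-] ->; apply/lamP; exists m.
Qed.

Lemma num_rowsE : num_rows T = count_mem 0 w.
Proof. exact: card_rows_longer. Qed.

Lemma num_rows_of_lenE (i : nat) : num_rows_of_len T i.+1 = col_mult w i.+1.
Proof.
rewrite /col_mult -!card_rows_longer /num_rows_of_len.
rewrite -[X in X - _](cardsID [set r : 'I_n | row_len T r == i.+1]).
set a := #|_ :&: _|; set b := #|_ :\: _|.
have -> : #|[set r | i.+1 < row_len T r]| = b.
  congr #|pred_of_set _|; apply/setP => r; rewrite !inE ltn_neqAle.
  by rewrite [_ == i.+1]eq_sym.
rewrite addnK; congr #|pred_of_set _|; apply/setP => r; rewrite !inE.
by case: eqP => [->|]; rewrite ?ltnSn ?andbF.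
Qed.

(** The index is computed after the insertion of [m] and compensated by the
    [+ 1]; the multiplicity is computed before. *)
Lemma box_sorting_indexE (m : 'I_n) :
  box_sorting_index T m = col_mult (take m w) (nth 0 w m).
Proof.
have := elimT (ballotP _) ballot_col_word m.
rewrite size_col_word => /(_ (ltn_ord m)).
rewrite /box_sorting_index nth_col_word; case E : (nat_of_ord (T m).2) => [|k].
  have szm : size (take m w) = m by rewrite size_takel ?size_col_word // ltnW.
  have := count_size (pred1 0) (take m w).
  rewrite /col_mult szm col_lenE // count_takeS ?size_col_word //.
  rewrite nth_col_word E /=.
  by move: (count _ _) => x; lia.
rewrite /col_mult !col_lenE // !count_takeS ?size_col_word // nth_col_word E /=.
rewrite eqxx gtn_eqF // addn0; move: (count _ _) (count _ _) => x y; lia.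
Qed.

Lemma word_weight_col_word :
  word_weight w = \prod_(m < n) box_sorting_index T m.
Proof.
under eq_bigr do rewrite box_sorting_indexE.
rewrite /word_weight.
rewrite -(big_mkord xpredT (fun m => col_mult (take m w) (nth 0 w m))).
by rewrite size_col_word big_mkord.
Qed.

End ColWord.

Lemma col_word_inj (n : nat) : {in SYT n &, injective (@col_word n)}.
Proof.
move=> T U TS US E; apply/ffunP => m.
have E2 : (T m).2 = (U m).2 by apply: val_inj; rewrite /= -!nth_col_word E.
by apply: eq_box; rewrite ?E2 // (SYT_rowE TS) (SYT_rowE US) E E2.
Qed.

Section WordTableau.
Variables (n : nat) (w : seq nat).
Hypotheses (sw : size w = n) (bw : ballot w).

(** [insubd] acts as a mere cast: for a ballot word of size [n] both coordinates
    are below [n] ([word_tableau1], [word_tableau2]). *)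
Definition word_tableau : {ffun 'I_n -> 'I_n * 'I_n} :=
  [ffun m : 'I_n => (insubd m (count_mem (nth 0 w m) (take m w)),
                     insubd m (nth 0 w m))].
Local Notation T := word_tableau.

Lemma word_tableau1 (m : 'I_n) :
  (T m).1 = count_mem (nth 0 w m) (take m w) :> nat.
Proof.
rewrite ffunE /= insubdK // unfold_in; apply: leq_ltn_trans (ltn_ord m).
by apply: leq_trans (count_size _ _) _; rewrite size_take_min geq_minl.
Qed.

Lemma word_tableau2 (m : 'I_n) : (T m).2 = nth 0 w m :> nat.
Proof.
rewrite ffunE /= insubdK // unfold_in -[X in _ < X]sw.
by rewrite ballot_lt // mem_nth ?sw.
Qed.

Lemma col_word_tableau : col_word T = w.
Proof.
apply: (@eq_from_nth _ 0); rewrite size_col_word ?sw // => m ltm.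
by rewrite (nth_col_word T (Ordinal ltm)) word_tableau2.
Qed.

Lemma mem_word_tableau (c : 'I_n * 'I_n) :
  (c \in [set T m | m : 'I_n]) = (c.1 < count_mem (nat_of_ord c.2) w).
Proof.
apply/imsetP/idP => [[m _ ->]|/occurrence[m]].
  rewrite word_tableau1 /= word_tableau2 -[X in _ < count _ X](take_size w) sw.
  by rewrite count_take_lt ?sw.
rewrite sw => ltm [E1 E2]; exists (Ordinal ltm) => //.
by apply: eq_box; rewrite ?word_tableau1 ?word_tableau2 /= E1 ?E2.
Qed.

(** The conjugate of the partition formed by the column lengths. *)
Definition word_shape : {ffun 'I_n -> 'I_n.+1} :=
  [ffun r : 'I_n => inord #|[set k : 'I_n | r < count_mem (k : nat) w]|].

Lemma word_shapeE (r : 'I_n) :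
  word_shape r = #|[set k : 'I_n | r < count_mem (k : nat) w]| :> nat.
Proof. by rewrite ffunE inordK // ltnS -[leqRHS]card_ord max_card. Qed.

Lemma word_shapeP (r k : 'I_n) :
  (k < word_shape r) = (r < count_mem (k : nat) w).
Proof.
rewrite word_shapeE card_ord_down // => i j leij ltj.
exact: leq_trans ltj (ballot_count_homo bw leij).
Qed.

Lemma word_shape_partition : is_partition word_shape.
Proof.
apply/andP; split.
  apply/forallP => i; apply/forallP => j; apply/implyP => leij.
  rewrite !word_shapeE; apply/subset_leq_card/fintype.subsetP => k.
  by rewrite !inE; apply: leq_ltn_trans.
rewrite -[X in _ == X]sw -(@sum_count_mem w n); last first.
  by move=> k; rewrite -sw; apply: ballot_lt.
under eq_bigr do rewrite word_shapeE -sum1_card big_mkcond.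
rewrite exchange_big /=; apply/eqP/eq_bigr => k _.
rewrite -[RHS](@card_ord_lt n); last by rewrite -[leqRHS]sw count_size.
by rewrite -sum1_card [RHS]big_mkcond; apply: eq_bigr => r _; rewrite !inE.
Qed.

Lemma word_tableau_SYT : T \in SYT n.
Proof.
rewrite inE; apply/and4P; split.
- apply/injectiveP => a b E.
  wlog: a b E / a <= b => [H|].
    by case: (leqP a b) => [/H->|/ltnW/H->].
  rewrite leq_eqVlt => /predU1P[/val_inj //|ltab].
  have E2 : nth 0 w a = nth 0 w b by rewrite -!word_tableau2 E.
  have := word_tableau1 a; rewrite E word_tableau1 -E2 => E1.
  by have := @count_take_lt w a b ltab; rewrite sw -E1 ltnn => /(_ (ltn_ord a)).
- apply/existsP; exists word_shape; rewrite word_shape_partition /=.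
  by apply/eqP/setP => c; rewrite mem_word_tableau [RHS]inE word_shapeP.
- apply/forallP => a; apply/forallP => b; apply/implyP.
  rewrite -val_eqE /= !word_tableau1 !word_tableau2 => /andP[/eqP E ltk].
  (* If [b] came before [a], the ballot condition at [b] would give the column
     of [a] more entries before [b] than the common row index, which is the
     number of its entries before [a]. *)
  rewrite ltnNge; apply/negP => leba.
  have := elimT (ballotP _) bw b; rewrite sw => /(_ (ltn_ord b)).
  case Eb : (nth 0 w b) ltk E => [//|j]; rewrite ltnS => lekj E.
  rewrite /col_mult subn_gt0 -E ltnNge => /negP; apply.
  apply: leq_trans (ballot_count_homo (ballot_take b bw) lekj) _.
  exact: count_take_le.
- apply/forallP => a; apply/forallP => b; apply/implyP.
  rewrite -val_eqE /= !word_tableau1 !word_tableau2 => /andP[/eqP <- ltr].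
  by rewrite ltnNge; apply: contraL ltr => leba; rewrite -leqNgt count_take_le.
Qed.

End WordTableau.

Lemma perm_col_words (n : nat) :
  perm_eq [seq col_word T | T <- enum (SYT n)] (ballot_words n).
Proof.
apply: uniq_perm; last 1 first.
- move=> w; rewrite mem_ballot_words; apply/mapP/andP => [[T]|[/eqP sw bw]].
    by rewrite mem_enum => TS ->; rewrite size_col_word eqxx ballot_col_word.
  exists (word_tableau n w); rewrite ?col_word_tableau //.
  by rewrite mem_enum word_tableau_SYT.
- rewrite map_inj_in_uniq ?enum_uniq // => T U; rewrite !mem_enum.
  exact: col_word_inj.
- exact: uniq_ballot_words.
Qed.

Local Open Scope ring_scope.

Theorem theorem36 (R : realType) (n : nat) (hn : (1 <= n)%N)
    (x : R) (hx : x != 0) :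
  (half_eulerian R n).[x] =
  \sum_(T in SYT n)
    (x ^+ (n - num_rows T) *
     \prod_(m < n)
       ((box_sorting_index T m)%:R *
        (peak_poly R m.+1).[x^-1] ^+ num_rows_of_len T m.+1)).
Proof.
apply: (mulfI hx); rewrite half_eulerianE -horner_iter_mul_riccati_deriv //.
rewrite (iter_mul_derivation _ (derivation_riccati_deriv x)) horner_sum.
rewrite -(perm_big _ (perm_col_words n)) /= big_map -big_enum mulr_sumr /=.
rewrite big_seq [RHS]big_seq; apply: eq_bigr => T; rewrite mem_enum => TS.
rewrite hornerMn horner_prod big_ord_recl /= horner_exp hornerX.
rewrite big_split /= -natr_prod -word_weight_col_word // num_rowsE //.
have lec : (count_mem 0 (col_word T) <= n)%N.
  by rewrite -[leqRHS](size_col_word T) count_size.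
rewrite {1}/col_mult size_col_word subSn // exprS -mulrA -mulr_natl mulrCA.
congr (_ * _); rewrite mulrCA; congr (_ * (_ * _)); apply: eq_bigr => k _.
by rewrite horner_exp horner_iter_riccati_deriv // num_rows_of_lenE.
Qed.
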